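(* Let $G,H$ be two graphs, with $H$ uniformly locally finite, and let $1 \in G$ be a basepoint. Then $$\alpha_1(G \wr H) \geq \frac{1}{2} \cdot \min(\alpha_1(G),\alpha_1(H)),$$ where $G \wr H = (G,1)\wr H$ is the wreath product of graphs and $\alpha_1$ denotes the $\ell^1$-compression.
   Context: Graphs are connected, identified with their vertex-sets, and viewed as metric spaces through the shortest-path metric. A graph is uniformly locally finite if there is a uniform upper bound on the degrees of its vertices. Wreath product of graphs: given graphs $G,H$ and a basepoint $1 \in G$, let $G^{(H)}$ denote the set of maps $\varphi : H \to G$ such that $\varphi(k)=1$ for all but finitely many $k \in H$. The wreath product $(G,1)\wr H$ is the graph whose vertices are the pairs $(\varphi,h)$ with $\varphi \in G^{(H)}$ and $h \in H$, and in which $(\varphi_1,h_1)$ and $(\varphi_2,h_2)$ are linked by an edge if either $\varphi_1=\varphi_2$ and $h_1,h_2$ are adjacent in $H$, or $h_1=h_2$ and $\varphi_1,\varphi_2$ differ only at $h_1=h_2$, with $\varphi_1(h_1),\varphi_2(h_1)$ adjacent in $G$. Compression: a Lipschitz map $f : R \to S$ between metric spaces has compression $\geq \alpha$ if there exists $C>0$ such that $d(f(a),f(b)) \geq C \cdot d(a,b)^\alpha$ for all distinct $a,b \in R$. The $\ell^1$-compression $\alpha_1(R)$ is the supremum of the $\alpha \in [0,1]$ such that there exists a Lipschitz map of compression $\geq \alpha$ from $R$ to an $\ell^1$-space. Here an $\ell^1$-space means a space $L^1(\Omega,\nu)$ for some measure space $(\Omega,\nu)$ (with this convention every median metric space embeds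 isometrically in an $\ell^1$-space). *)

(* Defs.v *)
From HB Require Import structures.
From mathcomp Require Import all_boot all_order all_algebra.
From mathcomp Require Import all_classical all_reals all_analysis.

Set Implicit Arguments.
Unset Strict Implicit.
Unset Printing Implicit Defensive.

Import Order.TTheory GRing.Theory Num.Theory.

Local Open Scope classical_set_scope.
Local Open Scope ring_scope.

Definition walk_to (V : Type) (e : rel V) (x y : V) (p : seq V) : Prop :=
  path e x p /\ last x p = y.

(* Simple connected graphs. The vertex set is arbitrary (possibly infinite,
   with vertices of infinite degree). *)
Record graph := Graph {
  vertex :> Type;
  adj : rel vertex;
  adj_sym : symmetric adj;
  adj_irr : irreflexive adj;
  adj_connected : forall x y : vertex, exists p, walk_to adj x y p
}.

Arguments adj {g} x y.

Section GraphDistance.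
Context (G : graph).
Implicit Types x y : G.

Lemma ex_walk_length x y :
  exists n : nat, `[< exists2 p, walk_to adj x y p & size p = n >].
Proof.
by have [p hp] := adj_connected x y; exists (size p); apply/asboolP; exists p.
Qed.

Definition graph_dist x y : nat := ex_minn (ex_walk_length x y).

Definition uniformly_locally_finite : Prop :=
  exists N : nat, forall x, ([set y | adj x y] #<= `I_N)%card.

End GraphDistance.

Section Wreath.
Context (G : graph) (o : G) (H : graph).

Definition finsupp_map : Type :=
  {phi : H -> G | finite_set [set k | phi k <> o]}.

Definition wreath_vertex : Type := (finsupp_map * H)%type.

Definition wreath_adj (u v : wreath_vertex) : bool :=
  `[< (u.1 = v.1 /\ adj u.2 v.2) \/
      [/\ u.2 = v.2,
          forall k, k <> u.2 -> sval u.1 k = sval v.1 k &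
          adj (sval u.1 u.2) (sval v.1 u.2)] >].

Lemma wreath_adj_sym : symmetric wreath_adj.
Proof.
suff h u v : wreath_adj u v -> wreath_adj v u by move=> u v; apply/idP/idP => /h.
move=> /asboolP[[e a]|[e d a]]; apply/asboolP.
  by left; rewrite adj_sym.
by right; rewrite -e; split=> [//|k /d//|]; rewrite adj_sym.
Qed.

Lemma wreath_adj_irr : irreflexive wreath_adj.
Proof. by move=> u; apply/asboolP => -[[_]|[_ _]]; rewrite adj_irr. Qed.

Let reach u v := exists p, walk_to wreath_adj u v p.

Let reach_trans v u w : reach u v -> reach v w -> reach u w.
Proof.
move=> [p [pp <-]] [q [pq <-]]; exists (p ++ q).
by split; rewrite ?cat_path ?pp ?last_cat.
Qed.

Let reach_step u v : wreath_adj u v -> reach u v.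
Proof. by move=> a; exists [:: v]; split=> //=; rewrite a. Qed.

Let reach_sym u v : reach u v -> reach v u.
Proof.
move=> [p]; elim: p u => [|w p ih] u [] /= => [_ <-|/andP[a pp] l].
  by exists [::].
apply: (@reach_trans w); first exact: ih.
by apply: reach_step; rewrite wreath_adj_sym.
Qed.

Let reach_base (phi : finsupp_map) (h k : H) : reach (phi, h) (phi, k).
Proof.
have [p] := adj_connected h k.
elim: p h => [|w p ih] h [] /= => [_ <-|/andP[a pp] l]; first by exists [::].
apply: (@reach_trans (phi, w)); last exact: ih.
by apply: reach_step; apply/asboolP; left.
Qed.

Let finsuppP (phi psi : finsupp_map) : sval phi =1 sval psi -> phi = psi.
Proof.
case: phi psi => [f pf] [g pg] /= /funext e; subst g.
by rewrite (Prop_irrelevance pf pg).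
Qed.

Let upd (f : H -> G) (k : H) (g : G) : H -> G :=
  fun i => if `[< i = k >] then g else f i.

Let upd_id f k g : upd f k g k = g.
Proof. by rewrite /upd asboolT. Qed.

Let upd_neq f k g i : i <> k -> upd f k g i = f i.
Proof. by move=> ik; rewrite /upd asboolF. Qed.

Let upd_fin (phi : finsupp_map) k g :
  finite_set [set i | upd (sval phi) k g i <> o].
Proof.
apply: (@sub_finite_set _ _ ([set i | sval phi i <> o] `|` [set k])).
  move=> i /=; have [->|ik] := pselect (i = k); first by right.
  by rewrite upd_neq //; left.
by rewrite finite_setU; split; [exact: (svalP phi)|exact: finite_set1].
Qed.

Let updf phi k g : finsupp_map := exist (fun f => finite_set [set i | f i <> o]) _ (upd_fin phi k g).

Let reach_fiber phi k g : reach (phi, k) (updf phi k g, k).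
Proof.
have [p] := adj_connected (sval phi k) g.
elim: p phi => [|w p ih] phi [] /= => [_ e|/andP[a pp] l].
  exists [::]; split=> //=; congr pair; apply: finsuppP => i /=.
  by have [->|ik] := pselect (i = k); rewrite ?upd_id ?upd_neq.
apply: (@reach_trans (updf phi k w, k)).
  apply: reach_step; apply/asboolP; right; split=> //=; last by rewrite upd_id.
  by move=> i ik; rewrite upd_neq.
rewrite (_ : updf phi k g = updf (updf phi k w) k g).
  by apply: ih; split; rewrite /= upd_id.
apply: finsuppP => i /=.
by have [->|ik] := pselect (i = k); rewrite ?upd_id // !upd_neq.
Qed.

Let finite_enum (T : Type) (A : set T) : finite_set A ->
  exists s : seq T, forall x, A x -> has (fun y => `[< x = y >]) s.
Proof.
elim/Pchoice: T => T in A *.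
move=> /finite_seqP[s ->]; exists s => x /=.
by move=> xs; apply/hasP; exists x => //; exact/asboolP.
Qed.

Let reach_trivial (phi psi : finsupp_map) (h : H) :
  (forall k, sval psi k = o) -> reach (phi, h) (psi, h).
Proof.
move=> psio; have [s] := finite_enum (svalP phi).
elim: s phi => [|k s ih] phi hs.
  exists [::]; split=> //=; congr pair; apply: finsuppP => i.
  by rewrite psio; apply: contrapT => /hs.
apply: (@reach_trans (phi, k)); first exact: reach_base.
apply: (@reach_trans (updf phi k o, k)); first exact: reach_fiber.
apply: (@reach_trans (updf phi k o, h)); first exact: reach_base.
apply: ih => i /=; have [->|ik] := pselect (i = k); first by rewrite upd_id.
by rewrite upd_neq // => /hs /= /orP[/asboolP|].
Qed.

Let trivial_fin : finite_set [set k : H | o <> o].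
Proof. by rewrite (_ : mkset _ = set0) // -subset0 => k /=. Qed.

Lemma wreath_connected u v : exists p, walk_to wreath_adj u v p.
Proof.
case: u v => [phi h] [psi k].
pose c : finsupp_map := exist (fun f => finite_set [set k | f k <> o]) (fun=> o) trivial_fin.
apply: (@reach_trans (c, h)); first exact: reach_trivial.
apply: (@reach_trans (c, k)); first exact: reach_base.
exact/reach_sym/reach_trivial.
Qed.

Definition wreath : graph :=
  Graph wreath_adj_sym wreath_adj_irr wreath_connected.

End Wreath.

Section Compression.
Context {R : realType}.

Section Maps.
Context {X Y : Type} (dX : X -> X -> R) (dY : Y -> Y -> R) (f : X -> Y).

Definition lipschitz_map : Prop :=
  exists K : R, forall a b, dY (f a) (f b) <= K * dX a b.

Definition compression_ge (alpha : R) : Prop :=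
  exists2 C : R, 0 < C &
    forall a b, a <> b -> C * (dX a b `^ alpha) <= dY (f a) (f b).

End Maps.

(* The norm below is finite on L^1, so [fine] loses nothing. *)
Definition L1_dist d (T : measurableType d) (mu : {measure set T -> \bar R})
    (f g : LspaceType1 mu) : R :=
  fine ('N[mu]_1[(fun x => (f x - g x)%:E)]).

(* The set of exponents is bounded and contains 0 (indicators of points in L^1
   of the counting measure), so that [sup] is a genuine supremum. *)
Definition l1_compression (X : Type) (dX : X -> X -> R) : R :=
  sup [set alpha : R | 0 <= alpha <= 1 /\
    exists (d : measure_display) (T : measurableType d)
      (mu : {measure set T -> \bar R}) (f : X -> LspaceType1 mu),
      lipschitz_map dX (@L1_dist d T mu) f /\
      compression_ge dX (@L1_dist d T mu) f alpha].

End Compression.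

Definition graph_l1_compression (R : realType) (G : graph) : R :=
  l1_compression (fun x y : G => (graph_dist x y)%:R : R).

(* Main.v *)
Require Import Defs.
From HB Require Import structures.
From mathcomp Require Import finmap all_boot all_order all_algebra.
From mathcomp Require Import all_classical all_reals all_analysis.
From mathcomp Require Import measurable_realfun.
From mathcomp Require Import lra zify.

(* If f : G -> L^1 and g : H -> L^1 have compression >= a, send (phi, h) to the
   family of all f (phi x), x in H, together with, for each coordinate t of
   the target of g, the position of (phi, h) in an R-tree attached to the real
   function y = +-g_t: its points are the pairs (s, phi restricted to {y <= s}),
   and (phi, h) sits at height s = y h.  A real tree embeds in l^1 of its branches,
   and a branch is recorded by a finitely supported map chi : H -> G.
   Writing S for the set where phi and psi differ, the image distance dominates
   N^a + D^a up to a constant, where N = sum over S of d(phi x, psi x) >= #|S| and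
   D = max of d(h, x) for x in S or x = k, because the tree geodesic from (phi, h)
   to (psi, k) descends below y x for each such x.  Visiting the points of S one at
   a time from h shows that the wreath distance is at most 2 N D + N + D, hence
   O(max(N, D)^2), and this square is the origin of the factor 1/2. *)

Set Implicit Arguments.
Unset Strict Implicit.
Unset Printing Implicit Defensive.

Import Order.TTheory GRing.Theory Num.Theory.
Import numFieldNormedType.Exports.
Local Open Scope classical_set_scope.
Local Open Scope ring_scope.

(* [i0] only serves to make the direct sum a pointed type. *)
Definition dsum (I : choiceType) (i0 : I) (d : I -> measure_display)
  (T : forall i, measurableType (d i)) : Type := {i : I & T i}.

(** * Direct sums of measure spaces over an arbitrary index set *)

Section DirectSum.
Context (I : choiceType) (i0 : I) (d : I -> measure_display)
  (T : forall i, measurableType (d i)).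
Local Notation S := (dsum i0 T).

HB.instance Definition _ := Choice.on S.
HB.instance Definition _ := isPointed.Build S (existT _ i0 (point : T i0) : S).

Definition dsum_in (i : I) (t : T i) : S := existT _ i t.

(** The largest sigma-algebra for which all the inclusions [dsum_in] are measurable. With it,
    measurability is checked summand by summand even when [I] is uncountable. *)
Definition dsum_measurable : set (set S) :=
  [set A | forall i, measurable (@dsum_in i @^-1` A)].

Let m0 : dsum_measurable set0.
Proof. by move=> i; rewrite preimage_set0. Qed.

Let mC A : dsum_measurable A -> dsum_measurable (~` A).
Proof. by move=> mA i; rewrite preimage_setC; exact: measurableC. Qed.

Let mU (F : (set S)^nat) : (forall n, dsum_measurable (F n)) ->
  dsum_measurable (\bigcup_n F n).
Proof.
by move=> mF i; rewrite preimage_bigcup; apply: bigcup_measurable => n _; exact: mF.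
Qed.

HB.instance Definition _ :=
  isMeasurable.Build default_measure_display S m0 mC mU.

Lemma measurable_dsum (A : set S) :
  (forall i, measurable (@dsum_in i @^-1` A)) -> measurable A.
Proof. by []. Qed.

Lemma measurable_dsum_in i : measurable_fun setT (@dsum_in i).
Proof. by move=> _ A mA; rewrite setTI; exact: mA. Qed.

Definition dsum_slice (i : I) : set S := [set z | tag z = i].

Lemma measurable_dsum_slice i : measurable (dsum_slice i).
Proof.
move=> j; have [->|ji] := eqVneq j i.
  by rewrite (_ : _ @^-1` _ = setT) //; apply/seteqP; split.
rewrite (_ : _ @^-1` _ = set0) //; apply/seteqP; split => // t /= /eqP.
by rewrite (negbTE ji).
Qed.

Context (R : realType) (mu : forall i, {measure set (T i) -> \bar R}).

Local Open Scope ereal_scope.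

Definition dsum_measure (A : set S) : \bar R :=
  \esum_(i in setT) mu i (@dsum_in i @^-1` A).

Let nu0 : dsum_measure set0 = 0.
Proof. by apply: esum1 => i _; rewrite preimage_set0 measure0. Qed.

Let nu_ge0 A : 0 <= dsum_measure A.
Proof. exact: esum_ge0. Qed.

(** All terms are nonnegative, so the series over [n] becomes an unordered sum and can be exchanged
    with the sum over [i] by swapping the pairs of indices. *)
Let nu_sigma_additive : semi_sigma_additive dsum_measure.
Proof.
move=> F mF tF mUF.
have -> : dsum_measure (\bigcup_n F n) = \sum_(n <oo) dsum_measure (F n).
  rewrite nneseries_esumT//.
  rewrite esum_esum // (reindex_esum ([set: I] `*`` fun=> [set: nat]) _
    (fun z => (z.2, z.1))); last first.
  - split.
    + by move=> [].
    + by move=> [? ?] [? ?] _ _ [-> ->].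
    + by move=> [x y] _; exists (y, x).
  rewrite -(esum_esum (a := fun i n => mu i (@dsum_in i @^-1` F n))) //.
  apply: eq_esum => i _.
  rewrite preimage_bigcup measure_bigcup //.
  - by rewrite -nneseries_esumT //; apply: eq_eseriesl => n; rewrite in_setT.
  - by move=> n _; exact: mF.
  - apply/trivIsetP => m n _ _ mn.
    rewrite -preimage_setI; move/trivIsetP: tF => /(_ m n Logic.I Logic.I mn) ->.
    by rewrite preimage_set0.
by apply: is_cvg_nneseries => n _ _; exact: nu_ge0.
Qed.

HB.instance Definition _ :=
  isMeasure.Build _ _ _ dsum_measure nu0 nu_ge0 nu_sigma_additive.

Lemma dsum_measure_slice i (A : set S) : measurable A -> A `<=` dsum_slice i ->
  dsum_measure A = mu i (@dsum_in i @^-1` A).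
Proof.
move=> mA Ai; rewrite /dsum_measure (esumID [set i]) // setTI esum_set1 //.
rewrite esum1 ?adde0 // => j /= [_ ji].
rewrite (_ : _ @^-1` _ = set0) ?measure0 //.
by apply/seteqP; split => // t /= /Ai /= /esym ij; apply: ji.
Qed.

(** The integral splits over the finitely many disjoint slices that carry [F], and on slice [i] the
    measure coincides with the pushforward of [mu i]. *)
Lemma ge0_integral_dsum (J : seq I) (F : S -> \bar R) : uniq J ->
  measurable_fun setT F -> (forall z, 0 <= F z) ->
  (forall z, tag z \notin J -> F z = 0) ->
  \int[dsum_measure]_z F z = \sum_(i <- J) \int[mu i]_t F (dsum_in t).
Proof.
move=> uJ mF F0 FJ.
transitivity (\int[dsum_measure]_(z in \big[setU/set0]_(i <- J) dsum_slice i) F z).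
  rewrite [RHS]integral_mkcond; apply: eq_integral => z _.
  rewrite patchE; case: ifPn => // /negP zJ.
  rewrite FJ //; apply/negP => zJ'; apply: zJ; apply/mem_set.
  by rewrite -bigcup_seq; exists (tag z).
rewrite ge0_integral_bigsetU //; last 3 first.
- by move=> i; exact: measurable_dsum_slice.
- apply/trivIsetP => i j _ _ ij; apply/seteqP; split => // z [zi zj].
  by rewrite -zi -zj eqxx in ij.
- exact: measurable_funTS.
apply: eq_bigr => i _.
have -> : \int[mu i]_t F (dsum_in t) =
    \int[mu i]_(t in @dsum_in i @^-1` dsum_slice i) (F \o @dsum_in i) t.
  by rewrite (_ : _ @^-1` _ = setT) //; apply/seteqP; split.
rewrite -(ge0_integral_pushforward (@measurable_dsum_in i)) //.
- apply: eq_measure_integral; first exact: measurable_dsum_in.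
  by move=> mi A mA Ai; exact: dsum_measure_slice.
- exact: measurable_dsum_slice.
- exact: measurable_funTS.
Qed.

End DirectSum.
Arguments dsum_measure {I} i0 {d T R} mu _.

(** * Maps into [L^1] built from integrable functions *)

Section L1Maps.
Context (R : realType).

Lemma Lspace1_integrable d (T : measurableType d) (mu : {measure set T -> \bar R})
  (f : LspaceType1 mu) : mu.-integrable setT (EFin \o f).
Proof.
apply/Lfun1_integrable; rewrite inE; apply/andP; split; rewrite inE /=.
  exact: (@measurable_funPT _ _ _ _ (repr (f : {mfun_ mu, T >-> measurableTypeR R}))).
exact: (@Lebesgue_finite _ _ _ _ _ _ f).
Qed.

(** A point of [LspaceType1] is a class of functions, whose chosen representative agrees with [f]
    only almost everywhere. This is enough for computing distances. *)
Lemma Lspace1_of_integrable d (T : measurableType d)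
    (mu : {measure set T -> \bar R}) (f : T -> R) :
  mu.-integrable setT (EFin \o f) ->
  exists g : LspaceType1 mu, ae_eq mu setT g f.
Proof.
move=> fi.
have mf : measurable_fun setT f by apply/measurable_EFinP; exact: measurable_int fi.
pose f' : {mfun T >-> measurableTypeR R} := HB.pack f (isMeasurableFun.Build _ _ T (measurableTypeR R) _ mf).
pose h : {mfun_ mu, T >-> measurableTypeR R} := (\pi f')%qT.
have hf : ae_eq mu setT h f.
  rewrite /h /aqEqMfun_to_fun; case: piP => g /eqmodP /asboolP.
  exact: ae_eq_sym.
have mh : measurable_fun setT (h : T -> R).
  exact: (@measurable_funPT _ _ _ _ (repr h)).
have hfin : finite_norm mu 1 h.
  rewrite /finite_norm Lnorm1.
  rewrite (ae_eq_integral (fun x => `|(f x)%:E|)%E) //.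
  - by have /integrableP[] := fi.
  - exact/measurableT_comp/measurable_EFinP.
  - exact/measurableT_comp/measurable_EFinP.
  - by apply: filterS hf => x hx Dx; rewrite /= hx.
pose g : LspaceType mu (@lexx _ _ 1%E) :=
  HB.pack h (@isFinLebesgue.Build _ _ _ mu 1%E (@lexx _ _ 1%E) h hfin).
exists g.
exact: hf.
Qed.

Lemma L1_map_of_integrable d (T : measurableType d)
    (mu : {measure set T -> \bar R}) (X : Type) (F : X -> T -> R) :
  (forall x, mu.-integrable setT (EFin \o F x)) ->
  exists f : X -> LspaceType1 mu, forall x y,
    L1_dist (f x) (f y) = \int[mu]_t `|F x t - F y t|.
Proof.
move=> Fi; have [f fF] := choice (fun x => Lspace1_of_integrable (Fi x)).
exists f => x y; rewrite /L1_dist Lnorm1 /Rintegral; congr fine.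
apply: ae_eq_integral => //.
- apply: measurableT_comp => //; apply/measurable_EFinP/measurable_funB.
    by have /measurable_int/measurable_EFinP := Lspace1_integrable (f x).
  by have /measurable_int/measurable_EFinP := Lspace1_integrable (f y).
- apply/measurable_EFinP; apply: measurableT_comp => //; apply: measurable_funB.
    by have /measurable_int/measurable_EFinP := Fi x.
  by have /measurable_int/measurable_EFinP := Fi y.
- by apply: filterS2 (fF x) (fF y) => t fx fy Dt; rewrite fx // fy.
Qed.

(** The family [f x] need not be summable over [I], but its difference with [f x0] lives on finitely
    many summands. Translating by [f x0] leaves all distances unchanged. *)
Lemma dsum_L1_map (I : choiceType) (i0 : I) (d : I -> measure_display)
    (T : forall i, measurableType (d i)) (mu : forall i, {measure set (T i) -> \bar R})
    (X : Type) (f : X -> forall i, T i -> R) (x0 : X) :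
  (forall x i, (mu i).-integrable setT (EFin \o f x i)) ->
  (forall x, exists2 J : seq I, uniq J & forall i, i \notin J -> f x i = f x0 i) ->
  exists F : X -> LspaceType1 (dsum_measure i0 mu), forall x y (J : seq I),
    uniq J -> (forall i, i \notin J -> f x i = f y i) ->
    L1_dist (F x) (F y) = \sum_(i <- J) \int[mu i]_t `|f x i t - f y i t|.
Proof.
move=> fi fJ.
pose F x (z : dsum i0 T) := f x (tag z) (tagged z) - f x0 (tag z) (tagged z).
have mF x : measurable_fun setT (F x).
  move=> _ A mA; rewrite setTI; apply: measurable_dsum => i.
  have mi : measurable_fun setT (fun t => f x i t - f x0 i t).
    by apply: measurable_funB;
      [have /measurable_int/measurable_EFinP := fi x i
      |have /measurable_int/measurable_EFinP := fi x0 i].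
  by have := mi measurableT _ mA; rewrite setTI.
have intF x : (dsum_measure i0 mu).-integrable setT (EFin \o F x).
  have [J uJ fxJ] := fJ x.
  apply/integrableP; split; first exact/measurable_EFinP.
  rewrite (@ge0_integral_dsum _ _ _ _ _ _ J) //.
  - apply: lte_sum_pinfty => i _.
    have := integrableB measurableT (fi x i) (fi x0 i).
    by move=> /integrableP[].
  - exact/measurableT_comp/measurable_EFinP.
  - by move=> z zJ; rewrite /= /F fxJ // subrr normr0.
have [G GF] := L1_map_of_integrable intF; exists G => x y J uJ xyJ.
have mFF : measurable_fun setT (fun z => `|F x z - F y z|).
  by apply: measurableT_comp => //; exact: measurable_funB.
rewrite GF /Rintegral (@ge0_integral_dsum _ _ _ _ _ _ J) //.
- have FE i t : F x (dsum_in i0 t) - F y (dsum_in i0 t) = f x i t - f y i t.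
    by rewrite /F /=; lra.
  under eq_bigr do under eq_integral do rewrite FE.
  rewrite -sum_fine // => i _.
  apply: integrable_fin_num => //.
  have := integrableB measurableT (fi x i) (fi y i).
  by move=> /integrable_norm.
- exact/measurable_EFinP.
- move=> z zJ; congr EFin.
  by rewrite /F xyJ // subrr normr0.
Qed.

End L1Maps.

(** * Minimum and maximum of a real function over a finite sequence *)

Section BigMinMax.
Context (R : realType) (K : eqType) (g : K -> R).
Implicit Types (a b c : R) (s : seq K).

Definition minl a s := \big[Num.min/a]_(x <- s) g x.
Definition maxl a s := \big[Num.max/a]_(x <- s) g x.

Lemma le_minl c a s : (c <= minl a s) = (c <= a) && all (fun x => c <= g x) s.
Proof.
rewrite /minl; elim: s => [|y s ih]; first by rewrite big_nil andbT.
by rewrite big_cons le_min ih andbCA.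
Qed.

Lemma minl_le c a s : (minl a s <= c) = (a <= c) || has (fun x => g x <= c) s.
Proof.
rewrite /minl; elim: s => [|y s ih]; first by rewrite big_nil orbF.
by rewrite big_cons ge_min ih orbCA.
Qed.

Lemma maxl_le c a s : (maxl a s <= c) = (a <= c) && all (fun x => g x <= c) s.
Proof.
rewrite /maxl; elim: s => [|y s ih]; first by rewrite big_nil andbT.
by rewrite big_cons ge_max ih andbCA.
Qed.

Lemma le_maxl c a s : (c <= maxl a s) = (c <= a) || has (fun x => c <= g x) s.
Proof.
rewrite /maxl; elim: s => [|y s ih]; first by rewrite big_nil orbF.
by rewrite big_cons le_max ih orbCA.
Qed.

Lemma minl_homo s a b : a <= b -> minl a s <= minl b s.
Proof.
move=> ab; rewrite le_minl; apply/andP; split.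
  by rewrite minl_le ab.
by apply/allP => x xs; rewrite minl_le; apply/orP; right; apply/hasP; exists x.
Qed.

Lemma maxl_homo s a b : a <= b -> maxl a s <= maxl b s.
Proof.
move=> ab; rewrite maxl_le; apply/andP; split.
  by rewrite le_maxl ab.
by apply/allP => x xs; rewrite le_maxl; apply/orP; right; apply/hasP; exists x.
Qed.

(** An initial value lying above some entry [g x] does not affect the minimum. *)
Lemma minl_absorb a b s x : x \in s -> g x <= b -> b <= a -> minl a s = minl b s.
Proof.
move=> xs xb ba; apply/eqP; rewrite eq_le (minl_homo _ ba) andbT le_minl.
apply/andP; split.
  by rewrite minl_le; apply/orP; right; apply/hasP; exists x.
by apply/allP => y ys; rewrite minl_le; apply/orP; right; apply/hasP; exists y.
Qed.

Lemma maxl_absorb a b s x : x \in s -> a <= g x -> b <= g x -> maxl a s = maxl b s.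
Proof.
wlog ab : a b / a <= b => [hw|].
  by case: (leP a b) => [|/ltW] ab xs ax bx; [exact: hw|apply/esym/hw].
move=> xs ax bx; apply/eqP; rewrite eq_le (maxl_homo _ ab) /= maxl_le.
apply/andP; split.
  by rewrite le_maxl; apply/orP; right; apply/hasP; exists x.
by apply/allP => y ys; rewrite le_maxl; apply/orP; right; apply/hasP; exists y.
Qed.

Lemma minl_id a s : (forall x, x \in s -> a <= g x) -> minl a s = a.
Proof.
move=> h; apply/eqP; rewrite eq_le minl_le lexx /= le_minl lexx /=.
exact/allP.
Qed.

Lemma maxl_id a s : (forall x, x \in s -> g x <= a) -> maxl a s = a.
Proof.
move=> h; apply/eqP; rewrite eq_le maxl_le lexx /= le_maxl lexx andbT.
exact/allP.
Qed.

End BigMinMax.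

(** * Branch coordinates of the R-tree attached to a real function on [H] *)

Section Truncations.
Context (G : graph) (o : G) (H : graph).
Local Notation F := (finsupp_map o H).
Implicit Types (phi psi chi : F) (x y h k : {classic H}).

Lemma finsupp_mapP phi psi : sval phi =1 sval psi -> phi = psi.
Proof.
case: phi psi => [f pf] [f' pf'] /= /funext e; subst f'.
by rewrite (Prop_irrelevance pf pf').
Qed.

Definition elems (A : set H) : seq {classic H} :=
  enum_fset (fset_set (A : set {classic H})).

Lemma mem_elems (A : set H) x : finite_set A -> x \in elems A <-> A x.
Proof.
move=> fA; have e := @in_fset_set {classic H} A fA x.
by split=> [xA|/mem_set]; [apply/set_mem|]; rewrite -e.
Qed.

Definition supp phi : seq {classic H} := elems [set x | sval phi x <> o].
Definition disagree phi psi : seq {classic H} :=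
  elems [set x | sval phi x <> sval psi x].

Lemma mem_supp phi x : x \in supp phi <-> sval phi x <> o.
Proof. by rewrite mem_elems //; exact: (svalP phi). Qed.

Lemma finite_disagree phi psi : finite_set [set x | sval phi x <> sval psi x].
Proof.
apply: (@sub_finite_set _ _
  ([set x | sval phi x <> o] `|` [set x | sval psi x <> o])).
  move=> x /= ne; apply: contrapT => /not_orP[/contrapT e /contrapT e'].
  by apply: ne; rewrite e e'.
by rewrite finite_setU; split; [exact: (svalP phi)|exact: (svalP psi)].
Qed.

Lemma mem_disagree phi psi x : x \in disagree phi psi <-> sval phi x <> sval psi x.
Proof. by rewrite mem_elems //; exact: finite_disagree. Qed.

Lemma restr_fin phi (p : pred H) :
  finite_set [set x | (if p x then sval phi x else o) <> o].
Proof. by apply: sub_finite_set (svalP phi) => x /=; case: ifP. Qed.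

Definition restr phi (p : pred H) : F :=
  exist (fun f : H -> G => finite_set [set x | f x <> o]) _ (restr_fin phi p).

(** The restrictions of [phi] to subsets of its support, enumerated by Boolean masks. They include
    every branch that the path below a point over [phi] can meet, whatever the function [g]. *)
Definition restrs phi : seq {classic F} :=
  undup [seq (restr phi (fun x => (x : {classic H}) \in mask m (supp phi)) : {classic F})
        | m : (size (supp phi)).-tuple bool].

Lemma mem_restrs phi chi :
  (forall x, sval chi x = o \/ sval chi x = sval phi x) -> chi \in restrs phi.
Proof.
move=> chiP; rewrite /restrs (@mem_undup {classic F}).
pose m := [seq `[< sval chi x <> o >] | x <- supp phi].
have sm : size m == size (supp phi) by rewrite size_map.
apply/mapP; exists (Tuple sm); first by rewrite mem_enum.
apply: finsupp_mapP => x /=; rewrite /m -filter_mask [_ \in _]mem_filter.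
case: ifPn => [/andP[/asboolP xo _]|].
  by have [] := chiP x.
rewrite negb_and => /orP[/asboolPn/contrapT //|xs].
have [//|->] := chiP x.
by apply: contrapT => /mem_supp; apply/negP.
Qed.

Lemma restr_restrs phi p : restr phi p \in restrs phi.
Proof.
by apply: mem_restrs => x /=; case: ifP; [right|left].
Qed.

Lemma notin_restrs phi chi : chi \notin restrs phi ->
  exists x, sval chi x <> o /\ sval chi x <> sval phi x.
Proof.
move=> /negP nchi; apply: contrapT => h; apply: nchi; apply: mem_restrs => x.
by apply: contrapT => /not_orP[? ?]; apply: h; exists x.
Qed.

Context (R : realType).
Implicit Types (g : {classic H} -> R) (a b c : R).

(* Coordinate on the branch [chi] of the point of height [a] over [phi]: [a] is
   cut down to the height where [phi] leaves [chi], then raised to the height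
   where the branch [chi] starts. Levels do not vanish off the path of the point,
   so only differences of levels are summable over [chi]. *)
Definition level g phi a chi : R :=
  maxl g (minl g a (disagree phi chi)) (supp chi).

Lemma level_homo g phi chi a b : a <= b -> level g phi a chi <= level g phi b chi.
Proof. by move=> ab; apply: maxl_homo; apply: minl_homo. Qed.

(** The path over [phi] has left the branch [chi] by height [g x], so going further up from [b] is
    invisible on [chi]. *)
Lemma level_absorb g phi chi a b x : sval phi x <> sval chi x ->
  g x <= b -> b <= a -> level g phi a chi = level g phi b chi.
Proof. by move=> /mem_disagree xd xb ba; rewrite /level (minl_absorb xd xb ba). Qed.

(** Each of the two maps disagrees with [chi] at a point of the support of [chi], so the cut-down
    height does not exceed the bottom of the branch. Both levels are then this bottom, the maximum
    of [g] over [supp chi]. *)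
Lemma level_const g phi psi chi a b x y :
  sval chi x <> o -> sval phi x <> sval chi x ->
  sval chi y <> o -> sval psi y <> sval chi y ->
  level g phi a chi = level g psi b chi.
Proof.
move=> xo xd yo yd.
wlog xy : x y phi psi a b xo xd yo yd / g x <= g y => [hw|].
  by case: (leP (g x) (g y)) => [|/ltW] xy;
    [exact: (hw x y)|apply/esym/(hw y x)].
rewrite /level; apply: (@maxl_absorb _ {classic H} _ _ _ _ y); first exact/mem_supp.
  rewrite minl_le; apply/orP; right; apply/hasP; exists x => //.
  exact/mem_disagree.
rewrite minl_le; apply/orP; right; apply/hasP; exists y => //.
exact/mem_disagree.
Qed.

Lemma level_notin_restrs g phi psi chi a b :
  chi \notin restrs phi -> chi \notin restrs psi ->
  level g phi a chi = level g psi b chi.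
Proof.
move=> /notin_restrs[x [xo xd]] /notin_restrs[y [yo yd]].
by apply: (@level_const g phi psi chi a b x y) => // /esym.
Qed.

Definition trunc g phi a : F := restr phi (fun x => g x <= a).

(** No point of the support of [phi] has height strictly between [b] and [c], so the path over [phi]
    stays on a single branch and covers the whole interval there. *)
Lemma level_trunc g phi b c : b <= c ->
  (forall x, sval phi x <> o -> b < g x -> c <= g x) ->
  level g phi c (trunc g phi b) - level g phi b (trunc g phi b) = c - b.
Proof.
move=> bc hc.
have hd x : x \in disagree phi (trunc g phi b) -> c <= g x.
  move=> /mem_disagree /=; case: ifPn => //; rewrite -ltNge => bx xo.
  exact: hc.
have hs x : x \in supp (trunc g phi b) -> g x <= b.
  by move=> /mem_supp /=; case: ifP.
rewrite /level (minl_id hd) (minl_id (a := b)); last first.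
  by move=> x /hd; exact: le_trans.
by rewrite (maxl_id hs) maxl_id // => x /hs xb; exact: le_trans bc.
Qed.

(** Let [x] be a point where [chi] differs from the truncation. If [g x <= b], the path has already
    left [chi]; otherwise [chi] is nontrivial at [x], and the path either disagrees with [chi] there
    or lies below its bottom up to height [c]. *)
Lemma level_not_trunc g phi chi b c : b <= c ->
  (forall x, sval phi x <> o -> b < g x -> c <= g x) ->
  chi <> trunc g phi b -> level g phi c chi = level g phi b chi.
Proof.
move=> bc hc ne.
have [x xne] : exists x, sval chi x <> sval (trunc g phi b) x.
  by apply: contrapT => h; apply: ne; apply: finsupp_mapP => x;
    apply: contrapT => xne; apply: h; exists x.
move: xne => /=; case: (leP (g x) b) => [xb xne|bx xo].
  by apply: (@level_absorb _ _ _ _ _ x) => // /esym.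
have [phix|phix] := pselect (sval phi x = o).
  by apply: (@level_const g phi phi chi c b x x) => // e; apply: xo; rewrite -e.
rewrite /level; apply: (@maxl_absorb _ {classic H} _ _ _ _ x); first exact/mem_supp.
  by rewrite minl_le hc.
by rewrite minl_le ltW.
Qed.

(* Each truncation of [phi] accounts for the interval of levels at which it is
   the current one, and these intervals tile [b, a]. *)
Lemma sum_level g phi (J : seq {classic F}) a b : uniq J ->
  {subset restrs phi <= J} -> b <= a ->
  \sum_(chi <- J) (level g phi a chi - level g phi b chi) = a - b.
Proof.
move=> uJ sJ.
suff main (s : seq {classic H}) : forall b, b <= a ->
    (forall x, sval phi x <> o -> b < g x -> x \in s) ->
    \sum_(chi <- J) (level g phi a chi - level g phi b chi) = a - b.
  move=> ba; apply: (main (supp phi)) => // x xo _; exact/mem_supp.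
have [n] := ubnP (size s); elim: n => // n ih in s * => sn {}b ba hs.
(* [c] is the next height at which the truncation can change, capped at [a]; between [b] and [c]
   only [trunc g phi b] contributes. *)
pose s' := [seq x <- s | b < g x]; pose c := minl g a s'.
have ca : c <= a by rewrite minl_le lexx.
have bc : b <= c.
  by rewrite le_minl ba; apply/allP => x; rewrite mem_filter => /andP[/ltW].
have hc x : sval phi x <> o -> b < g x -> c <= g x.
  move=> xo bx; rewrite minl_le; apply/orP; right; apply/hasP; exists x => //.
  by rewrite mem_filter bx; exact: hs.
have step : \sum_(chi <- J) (level g phi c chi - level g phi b chi) = c - b.
  rewrite (bigD1_seq (trunc g phi b : {classic F})) //=; last first.
    by apply: sJ; exact: restr_restrs.
  rewrite level_trunc // big1 ?addr0 // => chi /eqP ne.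
  by rewrite (@level_not_trunc g phi chi b c) ?subrr.
have -> : \sum_(chi <- J) (level g phi a chi - level g phi b chi) =
    \sum_(chi <- J) (level g phi a chi - level g phi c chi) + (c - b).
  by rewrite -step -big_split; apply: eq_bigr => chi _ /=; rewrite addrA subrK.
have [cE|ac] := eqVneq c a.
  by rewrite cE big1 ?add0r // => chi _; rewrite subrr.
suff -> : \sum_(chi <- J) (level g phi a chi - level g phi c chi) = a - c.
  by rewrite addrA subrK.
apply: (ih [seq x <- s | c < g x]) => //.
  (* Unfolding the left side only yields a point [y] of [s] with [g y <= c], since [c] is not [a].
     The filter drops this [y], so the list gets shorter. *)
  have : c <= c by []; rewrite {1}/c minl_le leNgt lt_neqAle ca ac /=.
  move=> /hasP[y]; rewrite mem_filter => /andP[_ ys] yc.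
  apply: leq_trans (sn : (size s <= n)%N); rewrite size_filter ltn_neqAle count_size andbT.
  by rewrite -all_count; apply/allPn; exists y => //; rewrite -leNgt.
by move=> x xo cx; rewrite mem_filter cx hs // (le_lt_trans bc).
Qed.

(** Over a fixed [phi] the levels are monotone in the height, so all terms have the same sign and
    [sum_level] applies. *)
Lemma sum_level_base g phi h k (J : seq {classic F}) : uniq J ->
  {subset restrs phi <= J} ->
  \sum_(chi <- J) `|level g phi (g h) chi - level g phi (g k) chi| = `|g h - g k|.
Proof.
move=> uJ sJ; wlog hk : h k / g k <= g h => [hw|].
  case: (leP (g k) (g h)) => [|/ltW] hk; first exact: hw.
  by rewrite distrC -hw //; apply: eq_bigr => chi _; rewrite distrC.
rewrite [RHS]ger0_norm ?subr_ge0 // -(sum_level g uJ sJ) //.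
by apply: eq_bigr => chi _; rewrite ger0_norm // subr_ge0 level_homo.
Qed.

(** A disagreement at [h] can only cut at height [g h], which is already the height of the point. *)
Lemma level_fiber g phi psi h chi :
  (forall x, x <> h -> sval phi x = sval psi x) ->
  level g phi (g h) chi = level g psi (g h) chi.
Proof.
suff main phi' psi' : (forall x, x <> h -> sval phi' x = sval psi' x) ->
    minl g (g h) (disagree phi' chi) <= minl g (g h) (disagree psi' chi).
  move=> e; rewrite /level; congr maxl; apply/eqP.
  by rewrite eq_le !main // => x /e.
move=> e; rewrite le_minl minl_le lexx /=.
apply/allP => x /mem_disagree xd; rewrite minl_le.
have [->|xh] := pselect (x = h); first by rewrite lexx.
apply/orP; right; apply/hasP; exists x => //.
by apply/mem_disagree; rewrite e.
Qed.

(** Compare with the sum of level increments over [phi] from [g x] to [g h]. A branch that [phi]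
    leaves by height [g x] has increment zero; on any other branch the point over [psi] lies no
    higher than the point of height [g x] over [phi]. *)
Lemma sum_level_ge g phi psi h k x (J : seq {classic F}) : uniq J ->
  {subset restrs phi <= J} -> x = k \/ sval phi x <> sval psi x ->
  g h - g x <= \sum_(chi <- J) `|level g phi (g h) chi - level g psi (g k) chi|.
Proof.
move=> uJ sJ xP; case: (leP (g h) (g x)) => [hx|/ltW xh].
  by rewrite (@le_trans _ _ 0) ?subr_le0 // sumr_ge0.
rewrite -(sum_level g uJ sJ xh); apply: ler_sum => chi _.
have [[y [yd yx]]|noy] := pselect (exists y, sval phi y <> sval chi y /\ g y <= g x).
  by rewrite (level_absorb yd yx xh) subrr.
apply: le_trans (ler_norm _); rewrite lerD2l lerN2.
have kx : minl g (g k) (disagree psi chi) <= g x.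
  rewrite minl_le; case: xP => [->|xd]; first by rewrite lexx.
  apply/orP; right; apply/hasP; exists x => //; apply/mem_disagree => xe.
  by apply: noy; exists x; split => //; rewrite -xe.
apply: maxl_homo; rewrite le_minl kx /=; apply/allP => y /mem_disagree yd.
rewrite (le_trans kx) // leNgt; apply/negP => /ltW yx.
by apply: noy; exists y.
Qed.

End Truncations.

(** * The shortest-path metric *)

Section GraphDist.
Context (X : graph).
Implicit Types x y z : X.

Lemma graph_dist_walk x y : exists2 p, walk_to adj x y p & size p = graph_dist x y.
Proof. by rewrite /graph_dist; case: ex_minnP => n /asboolP. Qed.

Lemma graph_dist_le x y p : walk_to adj x y p -> (graph_dist x y <= size p)%N.
Proof.
move=> w; rewrite /graph_dist; case: ex_minnP => n _; apply.
by apply/asboolP; exists p.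
Qed.

Lemma graph_dist_refl x : graph_dist x x = 0.
Proof. by apply/eqP; rewrite -leqn0; exact: (@graph_dist_le _ _ [::]). Qed.

Lemma graph_dist_eq0 x y : graph_dist x y = 0 -> x = y.
Proof. by have [p [_ lp] <-] := graph_dist_walk x y; case: p lp. Qed.

Lemma graph_dist_triangle x y z :
  (graph_dist x z <= graph_dist x y + graph_dist y z)%N.
Proof.
have [p [pp lp] <-] := graph_dist_walk x y; have [q [pq lq] <-] := graph_dist_walk y z.
by rewrite -size_cat graph_dist_le //; split; rewrite ?cat_path ?last_cat lp ?pp.
Qed.

Lemma graph_dist_adj x y : adj x y -> (graph_dist x y <= 1)%N.
Proof. by move=> a; apply: (@graph_dist_le _ _ [:: y]); split=> //=; rewrite a. Qed.

Lemma edge_lipschitz (R : realType) (D : X -> X -> R) (K : R) :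
  (forall x, D x x = 0) -> (forall x y z, D x z <= D x y + D y z) ->
  (forall x y, adj x y -> D x y <= K) ->
  forall x y, D x y <= K * (graph_dist x y)%:R.
Proof.
move=> D0 Dt DK x y; have [p [pp lp] <-] := graph_dist_walk x y.
elim: p x pp lp => [|z p ih] x /= => [_ <-|/andP[xz pp] lp].
  by rewrite D0 mulr0.
apply: le_trans (Dt x z y) _; rewrite -natr1 mulrDr mulr1 addrC.
by apply: lerD; [exact: ih|exact: DK].
Qed.

End GraphDist.

Lemma graph_dist_sym (X : graph) (x y : X) : graph_dist x y = graph_dist y x.
Proof.
suff h (a b : X) : (graph_dist a b <= graph_dist b a)%N.
  by apply/eqP; rewrite eqn_leq !h.
have [p [pp lp] <-] := graph_dist_walk b a.
elim: p b pp lp => [|z p ih] b /= => [_ <-|/andP[bz pp] lp].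
  by rewrite graph_dist_refl.
apply: leq_trans (graph_dist_triangle a z b) _; rewrite -addn1 leq_add ?ih //.
by rewrite graph_dist_adj // adj_sym.
Qed.

Lemma graph_dist_morph (X Y : graph) (f : X -> Y) :
  (forall x y, adj x y -> adj (f x) (f y)) ->
  forall x y, (graph_dist (f x) (f y) <= graph_dist x y)%N.
Proof.
move=> fP x y; have [p [pp lp] <-] := graph_dist_walk x y.
rewrite -(size_map f); apply: graph_dist_le.
split; last by rewrite last_map lp.
by elim: p x pp {lp} => //= z p ih x /andP[/fP -> /ih ->].
Qed.

(** * Upper bounds for distances in the wreath product *)

Section WreathDist.
Context (G : graph) (o : G) (H : graph).
Local Notation F := (finsupp_map o H).
Local Notation W := (wreath o H).
Implicit Types (phi psi : F) (h k x : {classic H}).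

Lemma upd_fin phi x (a : G) :
  finite_set [set y : {classic H} | (if y == x then a else sval phi y) <> o].
Proof.
apply: (@sub_finite_set _ _ ([set y | sval phi y <> o] `|` [set x])).
  by move=> y /=; case: eqVneq => [->|_] yo; [right|left].
by rewrite finite_setU; split; [exact: (svalP phi)|exact: finite_set1].
Qed.

Definition upd phi x (a : G) : F :=
  exist (fun f : H -> G => finite_set [set y | f y <> o]) _ (upd_fin phi x a).

Lemma wreath_dist_base phi h k :
  (@graph_dist W (phi, h) (phi, k) <= @graph_dist H h k)%N.
Proof.
apply: (@graph_dist_morph H W (fun x => (phi, x))) => x y xy.
by apply/asboolP; left.
Qed.

Lemma wreath_dist_fiber phi x (a : G) :
  (@graph_dist W (phi, x : H) (upd phi x a, x : H) <= graph_dist (sval phi x) a)%N.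
Proof.
(* With both ends written as updates of [phi] at [x], the fiber becomes the image of a graph
   morphism from [G]. *)
have {1}-> : phi = upd phi x (sval phi x).
  by apply: finsupp_mapP => y /=; case: eqP => // ->.
apply: (@graph_dist_morph G W (fun b => (upd phi x b, x : H))) => b c bc.
apply/asboolP; right; split=> //= [y yx|]; last by rewrite eqxx.
by case: eqP => // /yx.
Qed.

(** For each [x] in [s], walk from [h] to [x], change the value there, and walk back; the return
    trip accounts for the factor 2. *)
Lemma wreath_dist_lamps (s : seq {classic H}) phi psi h :
  (forall x, sval phi x <> sval psi x -> x \in s) ->
  (@graph_dist W (phi, h : H) (psi, h : H) <=
    \sum_(x <- s) (2 * @graph_dist H h x + graph_dist (sval phi x) (sval psi x)))%N.
Proof.
elim: s phi => [|x s ih] phi hs.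
  rewrite big_nil (_ : phi = psi) ?graph_dist_refl //.
  by apply: finsupp_mapP => x; apply: contrapT => /hs.
rewrite big_cons; pose phi' := upd phi x (sval psi x).
apply: leq_trans (@graph_dist_triangle W _ (phi', h : H) _) _.
apply: leq_add.
  apply: leq_trans (@graph_dist_triangle W _ (phi, x : H) _) _.
  rewrite mul2n -addnn -addnA; apply: leq_add; first exact: wreath_dist_base.
  apply: leq_trans (@graph_dist_triangle W _ (phi', x : H) _) _.
  rewrite addnC; apply: leq_add; last exact: wreath_dist_fiber.
  by rewrite (@graph_dist_sym H h x) wreath_dist_base.
apply: (leq_trans (ih phi' _)) => [y /=|].
  case: eqVneq => [-> //|yx /hs]; by rewrite inE (negbTE yx).
apply: leq_sum => y _; rewrite leq_add2l /=.
by case: eqVneq => // ->; rewrite graph_dist_refl.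
Qed.

Lemma wreath_dist_le phi psi h k (N D : nat) :
  N = (\sum_(x <- disagree phi psi) graph_dist (sval phi x) (sval psi x))%N ->
  (@graph_dist H h k <= D)%N ->
  (forall x, sval phi x <> sval psi x -> (@graph_dist H h x <= D)%N) ->
  (@graph_dist W (phi, h : H) (psi, k : H) <= 2 * N * D + N + D)%N.
Proof.
move=> NE kD hD.
apply: leq_trans (@graph_dist_triangle W _ (psi, h : H) _) _.
apply: leq_add; last exact: leq_trans (wreath_dist_base _ _ _) kD.
apply: (leq_trans (@wreath_dist_lamps (disagree phi psi) phi psi h _)) => [x xd|].
  exact/mem_disagree.
rewrite big_split /= -NE leq_add2r -big_distrr /= -mulnA leq_mul2l /=.
rewrite NE big_distrl /= big_seq [leqRHS]big_seq; apply: leq_sum => x /mem_disagree xd.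
(* Each disagreement contributes at least 1 to [N], so at most [N] points are visited, each at
   distance at most [D]. *)
apply: leq_trans (hD _ xd) _; rewrite leq_pmull // lt0n.
by apply/eqP => /graph_dist_eq0.
Qed.

End WreathDist.

(** * The [L^1] distance and integrability of levels *)

Section L1Dist.
Context (R : realType) (d : measure_display) (T : measurableType d)
  (mu : {measure set T -> \bar R}).
Implicit Types f g h : LspaceType1 mu.

Lemma L1_distE f g : L1_dist f g = \int[mu]_t `|f t - g t|.
Proof. by rewrite /L1_dist Lnorm1. Qed.

Lemma L1_dist_refl f : L1_dist f f = 0.
Proof.
rewrite L1_distE (@eq_Rintegral _ _ _ _ _ (cst 0)) ?Rintegral_cst ?mul0r //.
by move=> t _; rewrite subrr normr0.
Qed.

Lemma L1_dist_ge0 f g : 0 <= L1_dist f g.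
Proof. by rewrite L1_distE Rintegral_ge0. Qed.

Lemma integrable_normB f g :
  mu.-integrable setT (EFin \o (fun t => `|f t - g t|)).
Proof.
apply: integrable_norm.
by apply: eq_integrable (integrableB measurableT (Lspace1_integrable f)
  (Lspace1_integrable g)).
Qed.

Lemma L1_dist_triangle f g h : L1_dist f h <= L1_dist f g + L1_dist g h.
Proof.
rewrite !L1_distE -RintegralD //; try exact: integrable_normB.
apply: le_Rintegral => //; first exact: integrable_normB.
  by apply: eq_integrable (integrableD measurableT (integrable_normB f g)
    (integrable_normB g h)).
by move=> t _ /=; rewrite -(subrKA (g t)); exact: ler_normD.
Qed.

Lemma integrable_max (a b : T -> R) :
  mu.-integrable setT (EFin \o a) -> mu.-integrable setT (EFin \o b) ->
  mu.-integrable setT (EFin \o (fun t => Num.max (a t) (b t))).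
Proof.
move=> ia ib.
have ma : measurable_fun setT a by have /measurable_int/measurable_EFinP := ia.
have mb : measurable_fun setT b by have /measurable_int/measurable_EFinP := ib.
apply: (le_integrable measurableT _ _ (integrableD measurableT
  (integrable_norm ia) (integrable_norm ib))).
  by apply/measurable_EFinP; exact: measurable_maxr.
move=> t _; rewrite /= lee_fin [leRHS]ger0_norm ?addr_ge0 //.
by case: (leP (a t) (b t)) => _; rewrite ?lerDl ?lerDr.
Qed.

Lemma integrable_min (a b : T -> R) :
  mu.-integrable setT (EFin \o a) -> mu.-integrable setT (EFin \o b) ->
  mu.-integrable setT (EFin \o (fun t => Num.min (a t) (b t))).
Proof.
move=> ia ib.
have ma : measurable_fun setT a by have /measurable_int/measurable_EFinP := ia.
have mb : measurable_fun setT b by have /measurable_int/measurable_EFinP := ib.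
apply: (le_integrable measurableT _ _ (integrableD measurableT
  (integrable_norm ia) (integrable_norm ib))).
  by apply/measurable_EFinP; exact: measurable_minr.
move=> t _; rewrite /= lee_fin [leRHS]ger0_norm ?addr_ge0 //.
by case: (leP (a t) (b t)) => _; rewrite ?lerDl ?lerDr.
Qed.

Lemma integrable_level (G : graph) (o : G) (H : graph) (g : {classic H} -> T -> R)
    (phi chi : finsupp_map o H) (h : {classic H}) :
  (forall x, mu.-integrable setT (EFin \o g x)) ->
  mu.-integrable setT (EFin \o (fun t => level (g ^~ t) phi (g h t) chi)).
Proof.
move=> ig; rewrite /level.
have imin (s : seq {classic H}) :
    mu.-integrable setT (EFin \o (fun t => minl (g ^~ t) (g h t) s)).
  elim: s => [|y s ih].
    by apply: eq_integrable (ig h) => // t _; rewrite /= /minl big_nil.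
  apply: eq_integrable (integrable_min (ig y) ih) => // t _.
  by rewrite /= /minl big_cons.
elim: (supp chi) => [|y s ih].
  by apply: eq_integrable (imin _) => // t _; rewrite /= /maxl big_nil.
apply: eq_integrable (integrable_max (ig y) ih) => // t _.
by rewrite /= /maxl big_cons.
Qed.

End L1Dist.

Lemma uniq_inlr (A B : eqType) (s : seq A) (t : seq B) :
  uniq s -> uniq t -> uniq ([seq inl x | x <- s] ++ [seq inr y | y <- t] : seq (A + B)).
Proof.
move=> us ut; rewrite cat_uniq !map_inj_uniq ?us ?ut ?andbT //=; try by move=> ? ? [].
by apply/hasPn => _ /mapP[y _ ->]; apply/mapP => -[].
Qed.

(** * The map from the wreath product to [L^1] of a direct sum *)

Section WreathEmbedding.
Context (R : realType) (G : graph) (o : G) (H : graph).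
Local Notation F := (finsupp_map o H).
Context (d1 : measure_display) (T1 : measurableType d1)
  (mu1 : {measure set T1 -> \bar R}) (f : G -> LspaceType1 mu1).
Context (d2 : measure_display) (T2 : measurableType d2)
  (mu2 : {measure set T2 -> \bar R}) (g : H -> LspaceType1 mu2).

(** The points of [H] index the values of [f]; the two copies of [F] index the branches of the trees
    for [g] and for [- g]. *)
Let I : choiceType := ({classic H} + ({classic F} + {classic F}))%type.

Let d (i : I) := match i with inl _ => d1 | inr _ => d2 end.

Let T (i : I) : measurableType (d i) :=
  match i with inl _ => T1 | inr _ => T2 end.

Let mu (i : I) : {measure set (T i) -> \bar R} :=
  match i with inl _ => mu1 | inr _ => mu2 end.

Let gp (x : {classic H}) (t : T2) : R := g x t.
Let gm (x : {classic H}) (t : T2) : R := - g x t.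

Definition truncation_seq (u v : wreath o H) : seq {classic F} :=
  undup (restrs u.1 ++ restrs v.1).

(** The integral over [t] of the tree distance between the positions of [u] and [v]. Branches
    outside [truncation_seq u v] would contribute zero, by [level_notin_restrs]. *)
Definition level_dist (g' : {classic H} -> T2 -> R) (u v : wreath o H) : R :=
  \int[mu2]_t \sum_(chi <- truncation_seq u v)
    `|level (g' ^~ t) u.1 (g' u.2 t) chi - level (g' ^~ t) v.1 (g' v.2 t) chi|.

Let f' (u : wreath o H) (i : I) : T i -> R :=
  match i return T i -> R with
  | inl x => f (sval u.1 x)
  | inr (inl chi) => fun t => level (gp ^~ t) u.1 (gp u.2 t) chi
  | inr (inr chi) => fun t => level (gm ^~ t) u.1 (gm u.2 t) chi
  end.

Let J (u v : wreath o H) : seq I :=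
  [seq inl x | x <- disagree u.1 v.1] ++
  [seq inr x | x <- [seq inl y | y <- truncation_seq u v] ++
                    [seq inr y | y <- truncation_seq u v]].

Let uniqJ u v : uniq (J u v).
Proof.
by apply: uniq_inlr; [exact: fset_uniq|apply: uniq_inlr; exact: undup_uniq].
Qed.

Let f'J u v i : i \notin J u v -> @f' u i = @f' v i.
Proof.
case: i => [x|[chi|chi]] iJ.
- have xd : x \notin disagree u.1 v.1.
    by apply: contra iJ => xd; rewrite mem_cat map_f.
  rewrite /f'; have -> // : sval u.1 x = sval v.1 x.
  by apply: contrapT => /mem_disagree; exact/negP.
- have : chi \notin truncation_seq u v.
    by apply: contra iJ => cJ; rewrite mem_cat orbC map_f // mem_cat map_f.
  rewrite mem_undup mem_cat negb_or => /andP[cu cv].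
  by apply/funext => t; exact: level_notin_restrs.
- have : chi \notin truncation_seq u v.
    by apply: contra iJ => cJ; rewrite mem_cat orbC map_f // mem_cat orbC map_f.
  rewrite mem_undup mem_cat negb_or => /andP[cu cv].
  by apply/funext => t; exact: level_notin_restrs.
Qed.

Let integrable_gp x : mu2.-integrable setT (EFin \o gp x).
Proof. exact: Lspace1_integrable. Qed.

Let integrable_gm x : mu2.-integrable setT (EFin \o gm x).
Proof. by apply: eq_integrable (integrableN (Lspace1_integrable (g x))). Qed.

Let integrable_f' u i : (mu i).-integrable setT (EFin \o @f' u i).
Proof.
case: i => [x|[chi|chi]]; first exact: Lspace1_integrable.
- exact: (integrable_level _ _ _ integrable_gp).
- exact: (integrable_level _ _ _ integrable_gm).
Qed.

Lemma level_dist_sum (g' : {classic H} -> T2 -> R) (u v : wreath o H) :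
  (forall x, mu2.-integrable setT (EFin \o g' x)) ->
  level_dist g' u v = \sum_(chi <- truncation_seq u v) \int[mu2]_t
    `|level (g' ^~ t) u.1 (g' u.2 t) chi - level (g' ^~ t) v.1 (g' v.2 t) chi|.
Proof.
move=> ig'; rewrite /level_dist /Rintegral sum_fine; last first.
  move=> chi _; apply: integrable_fin_num => //.
  apply: integrable_norm.
  by apply: eq_integrable (integrableB measurableT
    (integrable_level _ _ _ ig') (integrable_level _ _ _ ig')).
congr fine; under eq_integral do rewrite -sumEFin.
rewrite integral_sum // => chi; apply: integrable_norm.
by apply: eq_integrable (integrableB measurableT
  (integrable_level _ _ _ ig') (integrable_level _ _ _ ig')).
Qed.

Lemma wreath_L1_map : exists (d : measure_display) (T : measurableType d)
    (mu : {measure set T -> \bar R}) (E : wreath o H -> LspaceType1 mu),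
  forall u v, L1_dist (E u) (E v) =
    \sum_(x <- disagree u.1 v.1) L1_dist (f (sval u.1 x)) (f (sval v.1 x))
    + (level_dist (fun x t => g x t) u v + level_dist (fun x t => - g x t) u v).
Proof.
(* If [H] is empty there is no vertex to serve as a base point, and the claim is vacuous. *)
case: (pselect (exists u : wreath o H, True)) => [[u0 _]|nou]; last first.
  exists d1, T1, mu1.
  have E (u : wreath o H) : LspaceType1 mu1 by exfalso; apply: nou; exists u.
  by exists E => u; exfalso; apply: nou; exists u.
have [|E EE] := @dsum_L1_map R I (inl u0.2) d T mu (wreath o H) (@f') u0 integrable_f'.
  by move=> u; exists (J u u0); [exact: uniqJ|move=> i; exact: f'J].
exists default_measure_display, (dsum (inl u0.2 : I) T), (dsum_measure (inl u0.2 : I) mu), E.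
move=> u v; rewrite (EE u v (J u v) (uniqJ u v) (@f'J u v)).
rewrite /J big_cat big_map /= big_map big_cat !big_map /=.
rewrite (@level_dist_sum gp) // (@level_dist_sum gm) //.
by congr (_ + _); apply: eq_bigr => x _; rewrite L1_distE.
Qed.

Lemma level_dist_base (g' : {classic H} -> T2 -> R) (u v : wreath o H) :
  u.1 = v.1 -> level_dist g' u v = \int[mu2]_t `|g' u.2 t - g' v.2 t|.
Proof.
move=> uv; apply: eq_Rintegral => t _; rewrite -uv.
apply: (@sum_level_base _ _ _ _ (g' ^~ t)); first exact: undup_uniq.
by move=> chi cu; rewrite mem_undup mem_cat cu.
Qed.

Lemma level_dist_fiber (g' : {classic H} -> T2 -> R) (u v : wreath o H) :
  u.2 = v.2 -> (forall x, x <> u.2 -> sval u.1 x = sval v.1 x) ->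
  level_dist g' u v = 0.
Proof.
move=> uv hx; rewrite /level_dist (@eq_Rintegral _ _ _ _ _ (cst 0)).
  by rewrite Rintegral_cst // mul0r.
move=> t _; rewrite big1 // => chi _.
by rewrite -uv (@level_fiber _ _ _ _ (g' ^~ t) u.1 v.1 u.2) // subrr normr0.
Qed.

(** For each [t], [sum_level_ge] is one-sided: the tree of [g] bounds the drop from [u.2] to [x] and
    the tree of [- g] bounds the rise. Together they bound the absolute value. *)
Lemma le_level_dist (u v : wreath o H) x :
  x = v.2 \/ sval u.1 x <> sval v.1 x ->
  L1_dist (g u.2) (g x) <=
    level_dist (fun x t => g x t) u v + level_dist (fun x t => - g x t) u v.
Proof.
move=> xP.
have int_level_dist (g' : {classic H} -> T2 -> R) :
    (forall x, mu2.-integrable setT (EFin \o g' x)) ->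
    mu2.-integrable setT (EFin \o (fun t => \sum_(chi <- truncation_seq u v)
    `|level (g' ^~ t) u.1 (g' u.2 t) chi - level (g' ^~ t) v.1 (g' v.2 t) chi|)).
  move=> ig'.
  have : mu2.-integrable setT (fun t => \sum_(chi <- truncation_seq u v)
      `|level (g' ^~ t) u.1 (g' u.2 t) chi
        - level (g' ^~ t) v.1 (g' v.2 t) chi|%:E)%E.
    apply: integrable_sum => // chi _; apply: integrable_norm.
    by apply: eq_integrable (integrableB measurableT
      (integrable_level _ _ _ ig') (integrable_level _ _ _ ig')).
  by apply: eq_integrable => // t _; rewrite /= sumEFin.
rewrite L1_distE /level_dist -RintegralD //; last 2 first.
- exact: (int_level_dist _ integrable_gp).
- exact: (int_level_dist _ integrable_gm).
apply: le_Rintegral => //.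
- exact: integrable_normB.
- by apply: eq_integrable (integrableD measurableT (int_level_dist _ integrable_gp)
    (int_level_dist _ integrable_gm)).
move=> t _; rewrite /=.
have uJ : uniq (truncation_seq u v) by exact: undup_uniq.
have sJ : {subset restrs u.1 <= truncation_seq u v}.
  by move=> chi cu; rewrite mem_undup mem_cat cu.
have := @sum_level_ge _ _ _ _ (gp ^~ t) u.1 v.1 u.2 v.2 x _ uJ sJ xP.
have := @sum_level_ge _ _ _ _ (gm ^~ t) u.1 v.1 u.2 v.2 x _ uJ sJ xP.
rewrite /gp /gm; set A := (\sum_(_ <- _) _); set B := (\sum_(_ <- _) _).
have A0 : 0 <= A by exact: sumr_ge0.
have B0 : 0 <= B by exact: sumr_ge0.
by case: (ger0P (g u.2 t - g x t)) => _; move: A0 B0; lra.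
Qed.

End WreathEmbedding.

(** * Inequalities between powers *)

Section Numeric.
Context (R : realType).

(** Each ratio [q = n x / N], with [N] the total, lies in []0, 1]], so [q <= q ^ a]. Multiplying by
    [N ^ a] and summing gives the claim. *)
Lemma sum_powR_ge (K : eqType) (s : seq K) (n : K -> nat) (a : R) :
  0 <= a <= 1 -> (forall x, x \in s -> (0 < n x)%N) ->
  (0 < \sum_(x <- s) n x)%N ->
  ((\sum_(x <- s) n x)%N%:R) `^ a <= \sum_(x <- s) ((n x)%:R : R) `^ a.
Proof.
move=> /andP[a0 a1] np; set N := (\sum_(x <- s) n x)%N => N0.
have NR : 0 < (N%:R : R) by rewrite ltr0n.
have -> : (N%:R : R) `^ a = \sum_(x <- s) N%:R `^ a * ((n x)%:R / N%:R).
  by rewrite -mulr_sumr -mulr_suml -natr_sum mulfV ?mulr1 ?gt_eqF.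
rewrite big_seq [leRHS]big_seq; apply: ler_sum => x xs.
have nN : (n x <= N)%N by rewrite /N (big_rem x xs) /= leq_addr.
have q0 : 0 < (n x)%:R / N%:R :> R by rewrite divr_gt0 // ltr0n np.
have -> : ((n x)%:R : R) `^ a = N%:R `^ a * ((n x)%:R / N%:R) `^ a.
  by rewrite -powRM ?ltW // mulrCA mulfV ?mulr1 ?gt_eqF.
rewrite ler_wpM2l ?powR_ge0 // -[leLHS](@powRr1 _ _ (ltW q0)) ger_powR //.
by rewrite q0 /= ler_pdivrMr // mul1r ler_nat.
Qed.

(** The bound on [n] is the square of [2 * m], so the exponent [a / 2] turns it into [(2 * m) ^ a],
    and [2 ^ a <= 2]. *)
Lemma half_powR_le (n m : nat) (a : R) : 0 <= a <= 1 ->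
  (n <= 4 * m ^ 2)%N -> (n%:R : R) `^ (a / 2) <= 2 * (m%:R `^ a).
Proof.
move=> /andP[a0 a1] nm.
apply: (@le_trans _ _ (((2 * m%:R) `^ 2) `^ (a / 2))).
  apply: ge0_ler_powR; rewrite ?nnegrE ?divr_ge0 ?powR_ge0 //.
  by rewrite powR_mulrn ?mulr_ge0 // exprMn -!natrX -natrM ler_nat.
rewrite -powRrM (mulrC 2 (a / 2)) divfK ?pnatr_eq0 // powRM // ler_wpM2r ?powR_ge0 //.
by rewrite -[leRHS](@powRr1 R) // ler_powR // ler1n.
Qed.

Lemma dist_bound (N D M : nat) : (N <= M)%N -> (D <= M)%N -> (0 < M)%N ->
  (2 * N * D + N + D <= 4 * M ^ 2)%N.
Proof.
move=> NM DM M0.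
have h1 : (N * D <= M * M)%N by exact: leq_mul.
have h2 : (M <= M * M)%N by rewrite leq_pmull.
rewrite expnS expn1; lia.
Qed.

End Numeric.

(** * Embeddability of the wreath product with half the exponent *)

Section Embeddable.
Context (R : realType).

Definition l1_embeddable (X : graph) (a : R) : Prop :=
  exists (d : measure_display) (T : measurableType d)
    (mu : {measure set T -> \bar R}) (f : X -> LspaceType1 mu),
    lipschitz_map (fun x y : X => (graph_dist x y)%:R : R) (@L1_dist R d T mu) f /\
    compression_ge (fun x y : X => (graph_dist x y)%:R : R) (@L1_dist R d T mu) f a.

(** Distinct vertices are at distance at least 1, where powers increase with the exponent. *)
Lemma l1_embeddable_le (X : graph) (a b : R) :
  a <= b -> l1_embeddable X b -> l1_embeddable X a.
Proof.
move=> ab [d [T [mu [f [lf [C C0 Cf]]]]]]; exists d, T, mu, f; split => //.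
exists C => // x y xy; apply: le_trans (Cf x y xy).
apply: ler_wpM2l; first exact: ltW.
apply: ler_powR => //; rewrite ler1n lt0n.
by apply/eqP => /graph_dist_eq0.
Qed.

Lemma wreath_l1_embeddable (G H : graph) (o : G) (a : R) : 0 <= a <= 1 ->
  l1_embeddable G a -> l1_embeddable H a -> l1_embeddable (wreath o H) (a / 2).
Proof.
move=> a01 [d1 [T1 [mu1 [f [[KG lf] [CG CG0 cf]]]]]].
move=> [d2 [T2 [mu2 [g [[KH lg] [CH CH0 cg]]]]]].
have [d [T [mu [E EE]]]] := @wreath_L1_map R G o H d1 T1 mu1 f d2 T2 mu2 g.
exists d, T, mu, E; split.
  (* An edge in a fiber costs at most the first term, and an edge along [H] the other two, one for
     each sign of [g]. Absolute values serve because [KG] and [KH] have no prescribed sign. *)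
  exists (`|KG| + (`|KH| + `|KH|)) => u v.
  apply: (@edge_lipschitz _ _ (fun u v => L1_dist (E u) (E v))) => [x|x y z|{}u {}v].
  - exact: L1_dist_refl.
  - exact: L1_dist_triangle.
  have edge (X : graph) (K : R) d' (T' : measurableType d')
      (mu' : {measure set T' -> \bar R}) (F : X -> LspaceType1 mu') (x y : X) :
      (forall a b, L1_dist (F a) (F b) <= K * (graph_dist a b)%:R) ->
      adj x y -> L1_dist (F x) (F y) <= `|K|.
    move=> lF xy; apply: le_trans (lF _ _) _.
    apply: (@le_trans _ _ (`|K| * (graph_dist x y)%:R)).
      by rewrite ler_wpM2r // ler_norm.
    by rewrite ler_piMr // -[1]/(1%:R) ler_nat graph_dist_adj.
  rewrite EE => /asboolP[[uv a2]|[uv dv a1]].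
    have e := edge _ _ _ _ _ g _ _ lg a2.
    rewrite !level_dist_base // big1_seq ?add0r; last first.
      by move=> x /andP[_ /mem_disagree]; rewrite uv.
    rewrite ler_wpDl //; apply: lerD; first by rewrite -L1_distE.
    rewrite (_ : \int[mu2]_t _ = L1_dist (g u.2) (g v.2)) // L1_distE.
    by apply: eq_Rintegral => t _; rewrite opprK addrC distrC.
  have e := edge _ _ _ _ _ f _ _ lf a1.
  rewrite !level_dist_fiber // !addr0.
  have ud : (u.2 : {classic H}) \in disagree u.1 v.1.
    by apply/mem_disagree => uv2; move: a1; rewrite uv2 adj_irr.
  rewrite (bigD1_seq _ ud (fset_uniq _)) /= big1_seq ?addr0; last first.
    move=> x /andP[/eqP xu /mem_disagree xd].
    by exfalso; apply: xd; exact: dv.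
  by rewrite ler_wpDr // addr_ge0.
(* The division by 2 absorbs the factor 2 of [half_powR_le]. *)
exists (Num.min CG CH / 2); first by rewrite divr_gt0 // lt_min CG0.
move=> u v uv; rewrite EE.
set A := \sum_(x <- _) _; set B := (X in _ <= A + X).
have A0 : 0 <= A by apply: sumr_ge0 => x _; exact: L1_dist_ge0.
have B0 : 0 <= B.
  by apply: addr_ge0; apply: Rintegral_ge0 => t _; apply: sumr_ge0.
pose N := (\sum_(x <- disagree u.1 v.1) graph_dist (sval u.1 x) (sval v.1 x))%N.
pose dh := fun x : {classic H} => @graph_dist H u.2 x.
pose D := (\max_(x <- (v.2 : {classic H}) :: disagree u.1 v.1) dh x)%N.
have DP x : x = v.2 \/ sval u.1 x <> sval v.1 x -> (dh x <= D)%N.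
  move=> xP; rewrite /D; apply: (@leq_bigmax_seq {classic H} _ xpredT dh x) => //.
  rewrite inE; case: xP => [->|/mem_disagree ->]; by rewrite ?eqxx ?orbT.
have duv : (graph_dist u v <= 2 * N * D + N + D)%N.
  rewrite (surjective_pairing u) (surjective_pairing v).
  apply: wreath_dist_le => //; first by apply: DP; left.
  by move=> x xd; apply: DP; right.
have NA : (0 < N)%N -> CG * (N%:R `^ a) <= A.
  move=> N0.
  have np x : x \in disagree u.1 v.1 -> (0 < graph_dist (sval u.1 x) (sval v.1 x))%N.
    by move=> /mem_disagree xd; rewrite lt0n; apply/eqP => /graph_dist_eq0.
  apply: (@le_trans _ _ (CG * \sum_(x <- disagree u.1 v.1)
      ((graph_dist (sval u.1 x) (sval v.1 x))%:R `^ a))).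
    by apply: ler_wpM2l; [exact: ltW|exact: sum_powR_ge].
  rewrite mulr_sumr /A big_seq [leRHS]big_seq; apply: ler_sum => x /mem_disagree.
  exact: cf.
have DB : (0 < D)%N -> CH * (D%:R `^ a) <= B.
  move=> D0.
  (* The maximum is attained: otherwise all entries would be at most [D.-1], and so would [D]. *)
  have [x xP xD] : exists2 x, x = v.2 \/ sval u.1 x <> sval v.1 x & dh x = D.
    apply: contrapT => nox; suff : (D <= D.-1)%N by rewrite leqNgt ltn_predL D0.
    apply/bigmax_leqP_seq => x xs _.
    have xP : x = v.2 \/ sval u.1 x <> sval v.1 x.
      by move: xs; rewrite inE => /orP[/eqP|/mem_disagree]; [left|right].
    have : (dh x <= D)%N by exact: DP.
    rewrite leq_eqVlt => /orP[/eqP xD|]; first by exfalso; apply: nox; exists x.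
    by rewrite -{1}(prednK D0) ltnS.
  apply: le_trans (le_level_dist g xP).
  rewrite -xD; apply: cg => ux.
  by move: D0; rewrite -xD /dh ux graph_dist_refl.
pose M := maxn N D.
(* If [N] and [D] both vanish, so does the distance bound [duv], against [u <> v]. *)
have M0 : (0 < M)%N.
  rewrite lt0n; apply/eqP => M0; apply: uv; apply: graph_dist_eq0.
  move: duv; have : (N <= M)%N by rewrite leq_maxl.
  have : (D <= M)%N by rewrite leq_maxr.
  rewrite M0 !leqn0 => /eqP -> /eqP ->.
  by rewrite leqn0 => /eqP.
have MAB : Num.min CG CH * (M%:R `^ a) <= A + B.
  have [ND|DN] := leqP N D.
    have MD : M = D by rewrite /M (maxn_idPr ND).
    rewrite MD in M0 *; apply: le_trans (_ : CH * (D%:R `^ a) <= _).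
      by rewrite ler_wpM2r ?powR_ge0 // ge_min lexx orbT.
    by apply: le_trans (DB M0) _; rewrite lerDr.
  have MN : M = N by rewrite /M (maxn_idPl (ltnW DN)).
  rewrite MN in M0 *; apply: le_trans (_ : CG * (N%:R `^ a) <= _).
    by rewrite ler_wpM2r ?powR_ge0 // ge_min lexx.
  by apply: le_trans (NA M0) _; rewrite lerDl.
apply: le_trans MAB.
rewrite -mulrA; apply: ler_wpM2l; first by rewrite le_min !ltW.
rewrite ler_pdivrMl //.
apply: half_powR_le => //; apply: leq_trans duv _.
by apply: dist_bound => //; rewrite ?leq_maxl ?leq_maxr.
Qed.

End Embeddable.

(** * From embeddability to the supremum of exponents *)

Section Sup.
Context (R : realType).
Let S (X : graph) := [set a : R | 0 <= a <= 1 /\ l1_embeddable X a].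

Let SE (X : graph) : graph_l1_compression R X = sup (S X).
Proof. by []. Qed.

Let ubS (X : graph) : has_ubound (S X).
Proof. by exists 1 => a [/andP[]]. Qed.

Lemma l1_compression_ge (X : graph) (a : R) : 0 <= a <= 1 ->
  l1_embeddable X a -> a <= graph_l1_compression R X.
Proof. by move=> a01 ea; rewrite SE; apply: ub_le_sup. Qed.

Lemma l1_compression_ge0 (X : graph) : 0 <= graph_l1_compression R X.
Proof.
have [[a Sa]|S0] := pselect (S X !=set0).
  case: (Sa) => a01 ea; apply: le_trans (l1_compression_ge a01 ea).
  by case/andP: a01.
(* The supremum of the empty set is 0 by convention, so no embedding with exponent 0 has to be
   exhibited. *)
rewrite SE (_ : S X = set0) ?sup0 //.
by apply/seteqP; split => // a Sa; apply: S0; exists a.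
Qed.

(** The supremum may not be attained, but some exponent above [a] is, and exponents are closed
    downwards. Positivity of the supremum excludes the empty set. *)
Lemma l1_compression_gt (X : graph) (a : R) : 0 <= a ->
  a < graph_l1_compression R X -> a <= 1 /\ l1_embeddable X a.
Proof.
rewrite SE => a0 aS.
have SX0 : S X !=set0.
  apply: contrapT => /set0P/negP; rewrite negbK => /eqP S0.
  by move: aS; rewrite S0 sup0 ltNge a0.
have [b [b01 eb] ab] := sup_gt SX0 aS.
split; first by case/andP: b01 => _; apply: le_trans; exact: ltW.
exact: l1_embeddable_le (ltW ab) eb.
Qed.

End Sup.

Theorem theorem1p5 (R : realType) (G H : graph) (o : G)
    (ulfH : uniformly_locally_finite H) :
  2^-1 * Num.min (graph_l1_compression R G) (graph_l1_compression R H)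
    <= graph_l1_compression R (wreath o H).
Proof.
set m := Num.min _ _; set s := graph_l1_compression R (wreath o H).
rewrite leNgt; apply/negP => sm.
have s0 : 0 <= s by exact: l1_compression_ge0.
(* The midpoint of [2 * s] and [m]: it stays below both compressions, while [a / 2] exceeds [s]. *)
pose a := s + m / 2.
have am : a < m by rewrite /a; lra.
have a0 : 0 <= a by rewrite /a; lra.
have [aG aH] : a < graph_l1_compression R G /\ a < graph_l1_compression R H.
  by move: am; rewrite lt_min => /andP[].
have [a1 eG] := l1_compression_gt a0 aG.
have [_ eH] := l1_compression_gt a0 aH.
have a01 : 0 <= a <= 1 by rewrite a0.
have := l1_compression_ge _ (wreath_l1_embeddable o a01 eG eH).
rewrite -/s; have a2 : 0 <= a / 2 <= 1 by lra.
by move=> /(_ a2); rewrite /a; lra.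
Qed.
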